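(* Let $A$ be an integral domain and let $Y$ be a nonempty collection of valuation overrings of $A$. Then $\wedge_Y$ is of finite type if and only if $Y$ is a compact subspace of $\mathrm{L}(A)$.
   Context: Let $A$ be an integral domain with quotient field $K$. $\overline{\mathbf F}(A)$ is the set of all nonzero $A$-submodules of $K$, and $\mathbf f(A)$ is the set of all nonzero finitely generated fractional ideals of $A$ (nonzero finitely generated $A$-submodules of $K$). A semistar operation on $A$ is a map $\star:\overline{\mathbf F}(A)\to\overline{\mathbf F}(A)$, $F\mapsto F^\star$, such that for all nonzero $k\in K$ and all $F,G\in\overline{\mathbf F}(A)$: $(kF)^\star=kF^\star$; $F\subseteq G$ implies $F^\star\subseteq G^\star$; $F\subseteq F^\star$; $(F^\star)^\star=F^\star$. A semistar operation $\star$ is of finite type if $F^\star=\bigcup\{G^\star:G\in\mathbf f(A),\,G\subseteq F\}$ for every $F\in\overline{\mathbf F}(A)$. An overring of $A$ is a ring $B$ with $A\subseteq B\subseteq K$. A valuation overring of $A$ is an overring of $A$ that is a valuation domain (with quotient field $K$; the field $K$ itself is allowed). For a nonempty set $Y$ of overrings of $A$, $\wedge_Y$ is the semistar operation on $A$ defined by $F^{\wedge_Y}:=\bigcap\{FB:B\in Y\}$ for $F\in\overline{\mathbf F}(A)$. $\mathrm{L}(A)$ is the set of all local overrings of $A$ (overrings with a unique maximal ideal, not necessarily Noetherian), endowed with the Zariski topology, which has as a basis of open sets the sets $\{C\in\mathrm{L}(A):F\subseteq C\}$, where $F$ ranges over the finite subsets of $K$. ''Compact'' means that every open cover has a finite subcover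 (no separation axiom). *)

(* Defs.v *)
From HB Require Import structures.
From mathcomp Require Import all_boot all_order all_algebra.
From mathcomp Require Import mathcomp_extra boolp classical_sets functions.
From mathcomp Require Import cardinality topology.

Set Implicit Arguments.
Unset Strict Implicit.
Unset Printing Implicit Defensive.

Import GRing.Theory.
Local Open Scope classical_set_scope.
Local Open Scope ring_scope.

(* The quotient field of [A] is [{fraction A}] and [A] is
   identified with the image of [tofrac : A -> {fraction A}]. *)

Notation tofrac := (@FracField.tofrac _).

Definition base_ring (A : idomainType) : set {fraction A} := range tofrac.

(* No closure under opposite is required: whenever [R] is a subring, it
   contains -1. *)
Definition submodule (K : fieldType) (R F : set K) : Prop :=
  [/\ F 0, forall x y, F x -> F y -> F (x + y)
    & forall r x, R r -> F x -> F (r * x)].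

Record fbar (A : idomainType) := Fbar {
  fbar_set :> set {fraction A};
  fbar_submodule : submodule (@base_ring A) fbar_set;
  fbar_neq0 : exists2 x, fbar_set x & x != 0 }.

Definition fin_gen (A : idomainType) (F : fbar A) : Prop :=
  exists (n : nat) (g : 'I_n -> {fraction A}),
    F = range (fun a : 'I_n -> A => \sum_(i < n) tofrac (a i) * g i)
      :> set {fraction A}.

Lemma fbar_eq (A : idomainType) (F G : fbar A) :
  F = G :> set {fraction A} -> F = G.
Proof.
case: F G => [F HF F0] [G HG G0] /= eFG; move: HF F0 HG G0; rewrite eFG.
by move=> *; congr Fbar; exact: Prop_irrelevance.
Qed.

Definition scale_set (K : fieldType) (k : K) (F : set K) : set K :=
  [set k * x | x in F].

Lemma scale_submodule (A : idomainType) (k : {fraction A}) (F : fbar A) :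
  submodule (@base_ring A) (scale_set k F).
Proof.
have [F0 FD FM] := fbar_submodule F; split.
- by exists 0 => //; rewrite mulr0.
- by move=> _ _ [x Fx <-] [y Fy <-]; exists (x + y); [exact: FD|rewrite mulrDr].
- by move=> r _ Rr [x Fx <-]; exists (r * x); [exact: FM|rewrite mulrCA].
Qed.

Lemma scale_neq0 (A : idomainType) (k : {fraction A}) (k0 : k != 0)
  (F : fbar A) : exists2 x, scale_set k F x & x != 0.
Proof.
by have [x Fx x0] := fbar_neq0 F; exists (k * x); [exists x|rewrite mulf_neq0].
Qed.

Definition scale (A : idomainType) (k : {fraction A}) (k0 : k != 0)
  (F : fbar A) : fbar A := Fbar (scale_submodule k F) (scale_neq0 k0 F).

Record semistar (A : idomainType) := Semistar {
  semistar_fun :> fbar A -> fbar A;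
  semistar_scale : forall (k : {fraction A}) (k0 : k != 0) (F : fbar A),
    semistar_fun (scale k0 F) = scale k0 (semistar_fun F);
  semistar_mono : forall F G : fbar A,
    F `<=` G -> semistar_fun F `<=` semistar_fun G;
  semistar_ext : forall F : fbar A, F `<=` semistar_fun F;
  semistar_idem : forall F : fbar A,
    semistar_fun (semistar_fun F) = semistar_fun F }.

Definition finite_type (A : idomainType) (star : semistar A) : Prop :=
  forall F : fbar A,
    star F = \bigcup_(G in [set G : fbar A | fin_gen G /\ G `<=` F]) star G
      :> set {fraction A}.

Record overring (A : idomainType) := Overring {
  overring_set :> set {fraction A};
  overring_subring : subring_closed (mem overring_set);
  overring_base : @base_ring A `<=` overring_set }.

(* A subring [B] of the field [K] that is a valuation domain with quotient
   field [K]; [B] = [K] is allowed. *)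
Definition valuation (K : fieldType) (B : set K) : Prop :=
  forall x : K, x != 0 -> B x \/ B x^-1.

Definition ideal (K : fieldType) (B I : set K) : Prop :=
  I `<=` B /\ submodule B I.

Definition maximal_ideal (K : fieldType) (B M : set K) : Prop :=
  [/\ ideal B M, M <> B
    & forall J, ideal B J -> M `<=` J -> J = M \/ J = B].

Definition local_ring (K : fieldType) (B : set K) : Prop :=
  exists! M : set K, maximal_ideal B M.

Record local_overring (A : idomainType) := LocalOverring {
  local_val :> overring A;
  local_valP : local_ring local_val }.

HB.instance Definition _ (A : idomainType) :=
  gen_eqMixin (local_overring A).
HB.instance Definition _ (A : idomainType) :=
  gen_choiceMixin (local_overring A).

Definition zariski_basic (A : idomainType) (F : set {fraction A}) :
  set (local_overring A) := [set C | F `<=` C].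

Lemma zariski_cover (A : idomainType) :
  \bigcup_(F in [set F : set {fraction A} | finite_set F]) zariski_basic F
    = setT.
Proof.
rewrite -subTset => C _; exists set0; first exact: finite_set0.
exact: sub0set.
Qed.

Lemma zariski_join (A : idomainType) (F G : set {fraction A})
  (C : local_overring A) :
  finite_set F -> finite_set G -> zariski_basic F C -> zariski_basic G C ->
  exists H : set {fraction A}, [/\ finite_set H, zariski_basic H C
    & zariski_basic H `<=` zariski_basic F `&` zariski_basic G].
Proof.
move=> fF fG FC GC; exists (F `|` G); split.
- by rewrite finite_setU.
- by rewrite /zariski_basic /= subUset.
- by move=> D; rewrite /zariski_basic /= subUset.
Qed.

HB.instance Definition _ (A : idomainType) :=
  isBaseTopological.Build (local_overring A)
    (@zariski_cover A) (@zariski_join A).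

Definition set_mul (K : fieldType) (F B : set K) : set K :=
  [set x | exists (n : nat) (f b : 'I_n -> K),
    [/\ forall i, F (f i), forall i, B (b i) & x = \sum_(i < n) f i * b i]].

Definition wedge_set (A : idomainType) (Y : set (overring A))
  (F : set {fraction A}) : set {fraction A} :=
  \bigcap_(B in Y) set_mul F B.

Lemma overringP (A : idomainType) (B : overring A) :
  [/\ overring_set B 1,
    forall x y, overring_set B x -> overring_set B y -> overring_set B (x - y)
    & forall x y,
      overring_set B x -> overring_set B y -> overring_set B (x * y)].
Proof.
case: B => B /= [B1 BB BM] _; split; first exact: set_mem.
- by move=> x y /mem_set Bx /mem_set By; exact/set_mem/BB.
- by move=> x y /mem_set Bx /mem_set By; exact/set_mem/BM.
Qed.

Lemma overring_submodule (A : idomainType) (B : overring A) : submodule B B.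
Proof.
have [B1 BB BM] := overringP B.
have B0 : overring_set B 0 by rewrite -(subrr 1); exact: BB.
split => // x y Bx By; rewrite -[y]opprK; apply: (BB) => //.
by rewrite -[- y]add0r; exact: BB.
Qed.

Lemma set_mul_min (K : fieldType) (F B G : set K) :
  G 0 -> (forall x y, G x -> G y -> G (x + y)) ->
  (forall x b, F x -> B b -> G (x * b)) -> set_mul F B `<=` G.
Proof.
move=> G0 GD GM _ [n [f [b [Ff Bb ->]]]].
by elim/big_ind: _ => // i _; exact: GM.
Qed.

Lemma set_mulP (K : fieldType) (F B : set K) :
  [/\ set_mul F B 0,
    forall x y, set_mul F B x -> set_mul F B y -> set_mul F B (x + y)
    & forall x b, F x -> B b -> set_mul F B (x * b)].
Proof.
split.
- exists 0, (fun=> 0), (fun=> 0); split; [by case|by case|].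
  by rewrite big_ord0.
- move=> _ _ [m [f [b [Ff Bb ->]]]] [n [g [c [Fg Bc ->]]]].
  exists (m + n)%N.
  exists (fun i => match fintype.split i with inl j => f j | inr j => g j end).
  exists (fun i => match fintype.split i with inl j => b j | inr j => c j end).
  split; [by move=> i; case: fintype.split..|].
  rewrite big_split_ord /=; congr (_ + _); apply: eq_bigr => i _.
  + case: fintype.splitP => j /= e.
      by have -> : i = j by exact/val_inj.
    by have := ltn_ord i; rewrite e ltnNge leq_addr.
  + case: fintype.splitP => j /= e.
      by have := ltn_ord j; rewrite -e ltnNge leq_addr.
    by have -> : i = j by apply/val_inj/(@addnI m).
- move=> x b Fx Bb; exists 1, (fun=> x), (fun=> b); split => //.
  by rewrite big_ord1.
Qed.

Lemma set_mulS (K : fieldType) (F G B : set K) :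
  F `<=` G -> set_mul F B `<=` set_mul G B.
Proof.
move=> FG _ [n [f [b [Ff Bb ->]]]]; exists n, f, b; split=> // i; exact: FG.
Qed.

Lemma set_mul_scale (K : fieldType) (k : K) (F B : set K) :
  set_mul (scale_set k F) B = scale_set k (set_mul F B).
Proof.
have [F0 FD FM] := set_mulP F B.
apply/seteqP; split.
- apply: set_mul_min.
  + by exists 0 => //; rewrite mulr0.
  + by move=> _ _ [x Fx <-] [y Fy <-]; exists (x + y);
      [exact: FD|rewrite mulrDr].
  + by move=> _ b [x Fx <-] Bb; exists (x * b); [exact: FM|rewrite mulrA].
- move=> _ [_ [n [f [b [Ff Bb ->]]]] <-].
  exists n, (fun i => k * f i), b; split=> //; first by move=> i; exists (f i).
  by rewrite mulr_sumr; apply: eq_bigr => i _; rewrite mulrA.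
Qed.

Lemma set_mul_ext (A : idomainType) (F : set {fraction A}) (B : overring A) :
  F `<=` set_mul F B.
Proof.
move=> x Fx; rewrite -[x]mulr1; have [_ _ FM] := set_mulP F B.
by have [B1 _ _] := overringP B; exact: FM.
Qed.

Lemma set_mul_idem (A : idomainType) (F : set {fraction A}) (B : overring A) :
  set_mul (set_mul F B) B = set_mul F B.
Proof.
apply/seteqP; split; last exact: set_mul_ext.
have [F0 FD FM] := set_mulP F B; have [_ _ BM] := overringP B.
apply: set_mul_min => // _ c [n [f [b [Ff Bb ->]]]] Bc.
exists n, f, (fun i => b i * c); split => //; first by move=> i; exact: BM.
by rewrite mulr_suml; apply: eq_bigr => i _; rewrite mulrA.
Qed.

Lemma wedge_submodule (A : idomainType) (Y : set (overring A)) (F : fbar A) :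
  submodule (@base_ring A) (wedge_set Y F).
Proof.
have [_ _ FM] := fbar_submodule F.
split; rewrite /wedge_set.
- by move=> B _; have [] := set_mulP F B.
- move=> x y Hx Hy B YB; have [_ + _] := set_mulP F B.
  by apply; [exact: Hx|exact: Hy].
- move=> r x Rr Hx B YB; have [n [f [b [Ff Bb ->]]]] := Hx B YB.
  exists n, (fun i => r * f i), b; split=> //; first by move=> i; exact: FM.
  by rewrite mulr_sumr; apply: eq_bigr => i _; rewrite mulrA.
Qed.

Lemma wedge_ext (A : idomainType) (Y : set (overring A))
  (F : set {fraction A}) : F `<=` wedge_set Y F.
Proof. by move=> x Fx B YB; exact: set_mul_ext. Qed.

Lemma wedge_neq0 (A : idomainType) (Y : set (overring A)) (F : fbar A) :
  exists2 x, wedge_set Y F x & x != 0.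
Proof.
by have [x Fx x0] := fbar_neq0 F; exists x => //; exact: wedge_ext.
Qed.

Definition wedge_fun (A : idomainType) (Y : set (overring A)) (F : fbar A) :
  fbar A := Fbar (wedge_submodule Y F) (wedge_neq0 Y F).

Lemma wedge_scale (A : idomainType) (Y : set (overring A))
  (k : {fraction A}) (k0 : k != 0) (F : fbar A) :
  wedge_fun Y (scale k0 F) = scale k0 (wedge_fun Y F).
Proof.
apply: fbar_eq; apply/seteqP; split=> x /=.
- move=> Hx; exists (k^-1 * x); last by rewrite mulVKf.
  move=> B YB; have := Hx B YB; rewrite set_mul_scale => -[y Hy <-].
  by rewrite mulKf.
- by move=> [y Hy <-] B YB; rewrite set_mul_scale; exists y => //; exact: Hy.
Qed.

Lemma wedge_mono (A : idomainType) (Y : set (overring A)) (F G : fbar A) :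
  F `<=` G -> wedge_fun Y F `<=` wedge_fun Y G.
Proof. by move=> FG x Hx B YB; exact/(set_mulS FG)/Hx. Qed.

Lemma wedge_idem (A : idomainType) (Y : set (overring A)) (F : fbar A) :
  wedge_fun Y (wedge_fun Y F) = wedge_fun Y F.
Proof.
apply: fbar_eq; apply/seteqP; split; last exact: wedge_ext.
move=> x Hx B YB; rewrite -set_mul_idem.
by apply: set_mulS (Hx B YB) => y; exact.
Qed.

Definition wedge (A : idomainType) (Y : set (overring A)) : semistar A :=
  Semistar (@wedge_scale A Y) (@wedge_mono A Y)
    (fun F => @wedge_ext A Y F) (@wedge_idem A Y).

Lemma valuation_local (A : idomainType) (B : overring A) :
  valuation B -> local_ring B.
Proof.
have := overringP B; have := overring_submodule B.
move: (overring_set B) => {}B [B0 BD _] [B1 BB BM] VB.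
pose M := [set x | B x /\ (x = 0 \/ ~ B x^-1)].
have unitM x : B x -> x != 0 -> ~ M x -> B x^-1.
  by move=> Bx x0 Mx; apply: contrapT => nB; apply: Mx; split=> //; right.
have Mmul r x : B r -> M x -> M (r * x).
  move=> Br [Bx Mx]; split; first exact: BM.
  have [->|r0] := eqVneq r 0; first by left; rewrite mul0r.
  case: Mx => [->|nBx]; first by left; rewrite mulr0.
  right => Brx; apply: nBx.
  by rewrite -[x^-1](mulKf r0) mulrCA -invfM; exact: BM.
have Madd x y : M x -> M y -> M (x + y).
  move=> Mx My; have [x0|x0] := eqVneq x 0; first by rewrite x0 add0r.
  have [y0|y0] := eqVneq y 0; first by rewrite y0 addr0.
  have xy0 : x / y != 0 by rewrite mulf_neq0 ?invr_neq0.
  have [|] := VB _ xy0.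
  - move=> Bxy; rewrite -(divfK y0 x) -{3}[y]mul1r -mulrDl.
    by apply: Mmul => //; exact: BD.
  - rewrite invf_div => Byx; rewrite -(divfK x0 y) -{1}[x]mul1r -mulrDl.
    by apply: Mmul => //; exact: BD.
have idM : ideal B M.
  by split; [move=> x []|split=> //; split=> //; left].
have nM1 : ~ M 1.
  by move=> [_ [/eqP|]]; rewrite ?oner_eq0// invr1.
have full J : ideal B J -> ~ J `<=` M -> J = B.
  move=> [JB [J0 _ JM]] /existsNP[x /not_implyP[Jx nMx]].
  have Bx := JB _ Jx.
  have x0 : x != 0 by apply/eqP => x0; apply: nMx; split=> //; left.
  apply/seteqP; split=> // y By; rewrite -(divfK x0 y).
  by apply: JM => //; apply: BM => //; exact: unitM.
have MB : M <> B by move=> eMB; apply: nM1; rewrite eMB.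
exists M; split.
- split=> // J idJ MJ; have [JM|nJM] := pselect (J `<=` M).
  + by left; apply/seteqP.
  + by right; exact: full.
- move=> N [idN NB maxN]; have [NM|nNM] := pselect (N `<=` M).
  + by have [|/MB] := maxN M idM NM.
  + by case: NB; exact: full.
Qed.

(* [Y] seen inside L(A); as every valuation overring is local, the preimage
   loses no element of [Y] (see [in_local_image]). *)
Definition in_local (A : idomainType) (Y : set (overring A)) :
  set (local_overring A) := @local_val A @^-1` Y.

Lemma in_local_image (A : idomainType) (Y : set (overring A)) :
  (forall V, Y V -> valuation V) -> @local_val A @` in_local Y = Y.
Proof.
move=> VY; apply/seteqP; split=> [_ [C YC <-] //|V YV].
by exists (LocalOverring (valuation_local (VY V YV))).
Qed.

(* Main.v *)
Require Import Defs.
From HB Require Import structures.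
From mathcomp Require Import all_boot all_order all_algebra.
From mathcomp Require Import boolp classical_sets topology.
From mathcomp Require Import finmap cardinality.

Import GRing.Theory.

Local Open Scope classical_set_scope.
Local Open Scope ring_scope.

(** Finite type and compactness both say that a relation which holds at every
    member of [Y] is already witnessed by finitely many elements of the
    quotient field [K].

    If [Y] is compact and [x] belongs to [F V] for every [V] in [Y], then a
    membership [x = \sum f_i v_i] at one [V] persists at every ring containing
    the finitely many [v_i] ([open_set_mul]).  So the sets of local overrings
    [C] with [x] in [s C], for [s] a finite sequence in [F], form an open cover
    of [Y]; a finite subcover concatenates into one finite generating sequence
    of a module [G] inside [F] with [x] in [G V] for every [V] in [Y]
    ([compact_finite_type]).

    Conversely, let [U] be an ultrafilter containing [Y], and suppose that it
    has no limit in [Y].  The elements [x] that are nonunits of [C] for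
    [U]-almost every [C] form a module [F], the maximal ideal of the valuation
    ring of all [x] that lie in [U]-almost every [C]
    ([limit_nonunits_submodule]).  A ring [C] in [Y] is not a limit of [U], so
    it contains some [x] that [U]-almost every ring misses
    ([cvg_local_overring]); then [x^-1] is in [F], whence 1 is in [F C].  Thus
    1 lies in [wedge Y F], and, by finite type, in [wedge Y G] for some finitely
    generated [G] inside [F].  The finitely many generators of [G] are
    simultaneously nonunits of some [C] in [Y], hence [G C] is inside the
    maximal ideal of [C], which cannot contain 1 ([set_mul_nonunits]). *)

(** * Finitely generated modules *)

Lemma set_mul_submodule {A : idomainType} (S : set {fraction A}) :
  submodule (@base_ring A) (set_mul S (@base_ring A)).
Proof.
have [S0 SD _] := set_mulP S (@base_ring A); split=> //.
move=> _ _ [r _ <-] [n [f [b [Sf Ab ->]]]].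
exists n, f, (fun i => tofrac r * b i); split=> //.
  by move=> i; have [c _ <-] := Ab i; exists (r * c); rewrite ?rmorphM.
by rewrite mulr_sumr; apply: eq_bigr => i _; rewrite mulrCA.
Qed.

Lemma set_mul_base {A : idomainType} (S : set {fraction A}) :
  S `<=` set_mul S (@base_ring A).
Proof.
move=> x Sx; have [_ _ SM] := set_mulP S (@base_ring A).
by rewrite -[x]mulr1; apply: SM => //; exists 1; rewrite ?rmorph1.
Qed.

Lemma set_mul_base_sub {A : idomainType} (S : set {fraction A}) (F : fbar A) :
  S `<=` F -> set_mul S (@base_ring A) `<=` F.
Proof.
have [F0 FD FM] := fbar_submodule F => SF.
by apply: set_mul_min => // x b Sx Ab; rewrite mulrC; apply: FM => //; exact: SF.
Qed.

Definition span {A : idomainType} (s : seq {fraction A})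
    (s0 : exists2 x, x \in s & x != 0) : fbar A :=
  Fbar (set_mul_submodule [set` s])
    (let: ex_intro2 x sx x0 := s0 in ex_intro2 _ _ x (set_mul_base _ _ sx) x0).

Lemma span_fin_gen {A : idomainType} (s : seq {fraction A})
  (s0 : exists2 x, x \in s & x != 0) : fin_gen (span s s0).
Proof.
exists (size s), (fun i => s`_i); apply/seteqP; split=> /=; last first.
  move=> _ [a _ <-]; exists (size s), (fun i => s`_i), (fun i => tofrac (a i)).
  split=> [i|i|]; [exact: mem_nth|by exists (a i)|].
  by apply: eq_bigr => i _; rewrite mulrC.
apply: set_mul_min.
- by exists (fun=> 0) => //; rewrite big1// => i _; rewrite rmorph0 mul0r.
- move=> _ _ [a _ <-] [b _ <-]; exists (fun i => a i + b i) => //.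
  by rewrite -big_split; apply: eq_bigr => i _; rewrite rmorphD mulrDl.
- move=> x _ /= sx [c _ <-]; have xs : (index x s < size s)%N by rewrite index_mem.
  exists (fun i => if i == Ordinal xs then c else 0) => //.
  rewrite (bigD1 (Ordinal xs))//= eqxx nth_index// big1 ?addr0 1?mulrC// => i.
  by move=> /negPf ->; rewrite rmorph0 mul0r.
Qed.

Lemma fin_gen_generator {A : idomainType} (n : nat) (g : 'I_n -> {fraction A})
    (i : 'I_n) :
  range (fun a : 'I_n -> A => \sum_(j < n) tofrac (a j) * g j) (g i).
Proof.
exists (fun j => (j == i)%:R) => //.
rewrite (bigD1 i)//= eqxx rmorph1 mul1r big1 ?addr0// => j /negPf ->.
by rewrite rmorph0 mul0r.
Qed.

(** * The Zariski topology on local overrings *)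

Lemma open_zariski_basic {A : idomainType} (F : set {fraction A}) :
  finite_set F -> open (zariski_basic F).
Proof. by move=> fF; exists [set F]; rewrite ?bigcup_set1// => _ ->. Qed.

(** Membership of [x] in [S C] involves only finitely many elements of [C], so
    it persists on the basic open set of the rings containing them. *)
Lemma open_set_mul {A : idomainType} (S : set {fraction A}) (x : {fraction A}) :
  open [set C : local_overring A | set_mul S C x].
Proof.
rewrite openE => C [n [f [b [Sf Cb ->]]]].
have /open_zariski_basic ob : finite_set (range b).
  exact/finite_image/finite_finset.
rewrite /interior nbhsE; exists (zariski_basic (range b)).
  by split=> // _ [i _ <-]; exact: Cb.
by move=> D bD; exists n, f, b; split=> // i; apply: bD; exists i.
Qed.

(** Each basic open set is a finite intersection of sets of the form
    [set D | D x], so a filter need only contain the latter. *)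
Lemma cvg_local_overring {A : idomainType} (U : set_system (local_overring A))
    (C : local_overring A) : Filter U ->
  (forall x, overring_set C x -> U [set D : local_overring A | overring_set D x]) -> U --> C.
Proof.
move=> UF UC P; rewrite /= nbhsE => -[O [[D' D'fin <-] [F D'F FC]] OP].
have fF : finite_set F := D'fin _ D'F.
suff : U (zariski_basic F) by apply: filterS => D FD; apply: OP; exists F.
have [s Fs] := (finite_seqP F).1 fF.
have : forall x, x \in s -> U [set D : local_overring A | overring_set D x].
  by move=> x xs; apply/UC/FC; rewrite Fs.
rewrite Fs {Fs}; elim: s => [_|x s IH Us].
  by apply: filterS filterT => D _ x; rewrite /= in_nil.
have Ux := Us x (mem_head _ _).
have := IH (fun y ys => Us y (mem_behead (ys : y \in behead (x :: s)))).
apply: filterS2 Ux => D Dx sD y /=.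
by rewrite inE => /orP[/eqP->|/sD].
Qed.

(** * Nonunits of valuation rings *)

(** For a valuation ring [B] this is its maximal ideal: if [B] misses the
    inverse of a nonzero [x], then [B] contains [x], as a nonunit. *)
Definition nonunits {K : fieldType} (B : set K) : set K :=
  [set x | x = 0 \/ ~ B x^-1].

Lemma nonunitsM {A : idomainType} (B : overring A) (r x : {fraction A}) :
  overring_set B r -> nonunits B x -> nonunits B (r * x).
Proof.
have [_ _ BM] := overringP B.
move=> Br [->|nBx]; first by left; rewrite mulr0.
have [->|r0] := eqVneq r 0; first by left; rewrite mul0r.
right=> Brx; apply: nBx; rewrite -[x^-1](mulKf r0) mulrCA -invfM.
exact: BM.
Qed.

(** One of [x / y] and [y / x] is in [B], so that [x + y] is a multiple of [x]
    or of [y] by an element of [B]. *)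
Lemma nonunitsD {A : idomainType} (B : overring A) (x y : {fraction A}) :
  valuation B -> nonunits B x -> nonunits B y -> nonunits B (x + y).
Proof.
have [B1 _ _] := overringP B; have [_ BD _] := overring_submodule B.
move=> VB Mx My.
have [->|x0] := eqVneq x 0; first by rewrite add0r.
have [->|y0] := eqVneq y 0; first by rewrite addr0.
have /VB[Bxy|] : x / y != 0 by rewrite mulf_neq0 ?invr_neq0.
  by rewrite -(divfK y0 x) -{3}[y]mul1r -mulrDl; apply: nonunitsM => //; exact: BD.
rewrite invf_div => Byx; rewrite -(divfK x0 y) -{1}[x]mul1r -mulrDl.
by apply: nonunitsM => //; exact: BD.
Qed.

Lemma nonunits1 {A : idomainType} (B : overring A) : ~ nonunits B 1.
Proof.
by have [B1 _ _] := overringP B => -[/eqP|]; rewrite ?oner_eq0// invr1.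
Qed.

Lemma set_mul_nonunits {A : idomainType} (B : overring A)
    (S : set {fraction A}) :
  valuation B -> S `<=` nonunits B -> set_mul S B `<=` nonunits B.
Proof.
move=> VB SM; apply: set_mul_min; first by left.
- by move=> x y; exact: nonunitsD.
- by move=> x b Sx Bb; rewrite mulrC; apply: nonunitsM => //; exact: SM.
Qed.

Definition limit_nonunits {A : idomainType}
    (U : set_system (local_overring A)) : set {fraction A} :=
  [set x | U [set C : local_overring A | nonunits C x]].

Lemma limit_nonunits_submodule {A : idomainType}
    (U : set_system (local_overring A)) : Filter U ->
  U [set C : local_overring A | valuation C] ->
  submodule (@base_ring A) (limit_nonunits U).
Proof.
move=> UF UV; split.
- by apply: filterS filterT => C _; left.
- by move=> x y; apply: filterS3 UV => C /=; exact: nonunitsD.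
- move=> r x Ar; apply: filterS => C; apply: nonunitsM.
  exact: (@overring_base A C).
Qed.

(** * Finite type against compactness *)

(** [compact_cover] speaks of pointed spaces; any point of [K] provides the
    pointed structure, over the same topology. *)
Lemma compact_cover_compact {T : topologicalType} (K : set T) :
  K !=set0 -> compact K -> cover_compact K.
Proof.
move=> [x _]; pose pT : ptopologicalType := HB.pack T (isPointed.Build T x).
by rewrite -[@cover_compact T]/(@cover_compact pT) -compact_cover.
Qed.

(** Applied to the module of [limit_nonunits], finite type turns the failure of
    convergence of an ultrafilter into finitely many elements that generate the
    unit ideal in every member of [Y], yet are all nonunits in one of them. *)
Lemma finite_type_compact {A : idomainType} (Y : set (overring A)) :
  Y !=set0 -> (forall V : overring A, Y V -> valuation V) ->
  finite_type (wedge Y) -> compact (in_local Y).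
Proof.
move=> [V0 YV0] VY ftY; rewrite compact_ultra => U UU UY.
apply: contrapT => nolim.
have missing V : Y V ->
    exists x, [/\ overring_set V x, x != 0 & limit_nonunits U x^-1].
  move=> YV; pose C := LocalOverring (valuation_local (VY V YV)).
  have [x /not_implyP[Cx nUx]] : exists x, ~ (overring_set C x ->
      U [set D : local_overring A | overring_set D x]).
    apply/existsNP => UC; apply: nolim; exists C; split => //.
    exact: cvg_local_overring.
  exists x; split=> //.
    apply/eqP => x0; apply: nUx; rewrite x0; apply: filterS filterT => D _.
    by have [D0 _ _] := overring_submodule D.
  have [//|UnD] := in_ultra_setVsetC
    [set D : local_overring A | overring_set D x] UU.
  by apply: filterS UnD => D nDx; right; rewrite invrK.
have F0 : exists2 x, limit_nonunits U x & x != 0.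
  by have [x [_ x0 Fx]] := missing V0 YV0; exists x^-1; rewrite ?invr_eq0.
have UV : U [set C : local_overring A | valuation C].
  by apply: filterS UY => C; exact: VY.
have FM : submodule (@base_ring A) (limit_nonunits U).
  exact: limit_nonunits_submodule.
pose F := Fbar FM F0.
have : fbar_set (wedge Y F) 1.
  move=> V YV; have [x [Vx x0 Fx]] := missing V YV.
  have [_ _ FV] := set_mulP F V.
  by rewrite -(mulVf x0); exact: FV.
rewrite ftY => -[G [[n [g Gg]] GF] G1].
have Ug : U [set C : local_overring A | forall i, nonunits C (g i)].
  apply: filter_forall => i; apply: GF; rewrite Gg; exact: fin_gen_generator.
have [C [YC Cg]] := @filter_ex _ U _ _ (filterI UY Ug).
apply: (@nonunits1 A C); have := G1 C YC.
apply: set_mul_nonunits; first exact: VY.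
rewrite Gg => _ [a _ <-]; elim/big_ind: _ => [|x y|i _]; first by left.
  by apply: nonunitsD; exact: VY.
by apply: nonunitsM => //; apply: (@overring_base A C); exists (a i).
Qed.

(** The cover is indexed by finite sequences in [F], so that concatenating the
    indices of a finite subcover yields the generators at once. *)
Lemma compact_finite_type {A : idomainType} (Y : set (overring A)) :
  (forall V : overring A, Y V -> local_ring V) ->
  cover_compact (in_local Y) -> finite_type (wedge Y).
Proof.
move=> LY cY F; apply/seteqP; split; last first.
  by move=> x [G [_ GF]]; exact: semistar_mono.
move=> x Fx; pose D := [set s : seq {fraction A} | [set` s] `<=` F].
have [E ED Ecov] : finite_subset_cover D
    (fun s => [set C : local_overring A | set_mul [set` s] C x]) (in_local Y).
  apply: cY => [s _|C YC]; first exact: open_set_mul.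
  have [n [f [b [Ff Cb ->]]]] := Fx C YC.
  exists (codom f); first by move=> _ /codomP[i ->].
  by exists n, f, b; split=> // i; exact: codom_f.
have [w Fw w0] := fbar_neq0 F.
(* The sequences of the subcover might all be empty or zero (for [x = 0]);
   adjoining [w] makes the module nonzero. *)
pose s := w :: flatten (enum_fset E).
have s0 : exists2 z, z \in s & z != 0 by exists w; rewrite ?mem_head.
exists (span s s0).
  split; first exact: span_fin_gen.
  apply: set_mul_base_sub => z /=; rewrite inE => /orP[/eqP-> //|].
  by move=> /flattenP[t /ED /set_mem Dt /Dt].
move=> V YV.
have [t /= Et] := Ecov (LocalOverring (LY V YV)) YV.
apply: set_mulS => z tz; apply: set_mul_base => /=.
by rewrite inE; apply/orP; right; apply/flattenP; exists t.
Qed.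

Theorem proposition4p5 (A : idomainType) (Y : set (overring A))
    (Y0 : Y !=set0) (VY : forall V : overring A, Y V -> valuation V) :
  finite_type (wedge Y) <-> cover_compact (in_local Y).
Proof.
split; last by apply: compact_finite_type => V /VY; exact: valuation_local.
move=> ftY; have [V YV] := Y0; apply: compact_cover_compact.
  by exists (LocalOverring (valuation_local (VY V YV))).
exact: finite_type_compact.
Qed.
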